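(* (Region counting formula for arrangements of tropical hypersurfaces.) Let $g_1,\dots,g_m:\mathbb{R}^d\to\mathbb{R}$ be tropical polynomials. Then $$\mathrm{mComp}(g_1\odot\cdots\odot g_m)=\mathrm{fComp}(g_1,\dots,g_m)+\sum_{k=2}^m(-1)^{k+d}\sum_{S\in\binom{[m]}{k}}\chi\Big(\bigcap_{i\in S}\mathcal{V}(g_i)\Big).$$
   Context: A tropical polynomial on $\mathbb{R}^d$ is a function $g(x)=\max_{1\le i\le n}(\langle b_i,x\rangle+a_i)$ with $a_i\in\mathbb{R}$, $b_i\in\mathbb{R}^d$; $g\odot h$ denotes $g+h$. $\mathcal{V}(g)=\{x\in\mathbb{R}^d:g\text{ is not affine in any neighbourhood of }x\}$, the tropical hypersurface of $g$; it is a polyhedral complex. $\mathrm{mComp}(g)$ is the number of linear regions of $g$, i.e. the number of connected components of $\mathbb{R}^d\setminus\mathcal{V}(g)$. $\mathrm{fComp}(g_1,\dots,g_m)=\sum_{i=1}^m\mathrm{mComp}(g_i)-(m-1)$. $\binom{[m]}{k}$ is the set of $k$-element subsets of $\{1,\dots,m\}$. The Euler characteristic $\chi(X)$ of a polyhedral complex $X$ (possibly with unbounded faces) is $\sum_{i=0}^d(-1)^i\cdot(\text{number of }i\text{-dimensional faces of }X)$, counting bounded and unbounded faces; it does not depend on the polyhedral structure chosen, and $\chi(\emptyset)=0$. *)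

(* Defs.v *)
From mathcomp Require Export all_boot all_order all_algebra.
From mathcomp Require Export finmap.
From mathcomp Require Export all_classical all_reals all_analysis.

Set Implicit Arguments.
Unset Strict Implicit.
Unset Printing Implicit Defensive.

Import Order.TTheory GRing.Theory Num.Theory.
Import numFieldNormedType.Exports.

Local Open Scope fset_scope.
Local Open Scope classical_set_scope.
Local Open Scope ring_scope.

Section TropicalHypersurfaces.
Variables (R : realType) (d : nat).
Implicit Types (x y u : 'rV[R]_d) (g : 'rV[R]_d -> R) (P F X : set 'rV[R]_d).

Definition dotp u x : R := \sum_(j < d) u 0 j * x 0 j.

(* The index set 'I_n.+1 makes the maximum a nonempty one; the default element
   of the big operator is then one of the terms and plays no role. *)
Definition tropical_polynomial g : Prop :=
  exists (n : nat) (b : 'I_n.+1 -> 'rV[R]_d) (a : 'I_n.+1 -> R),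
    forall x, g x =
      \big[Num.max/dotp (b ord0) x + a ord0]_(i < n.+1) (dotp (b i) x + a i).

Definition affine_near g x : Prop :=
  exists (b : 'rV[R]_d) (a : R), \forall y \near x, g y = dotp b y + a.

Definition trop_hypersurface g : set 'rV[R]_d := [set x | ~ affine_near g x].

Definition components X : set (set 'rV[R]_d) :=
  [set connected_component X x | x in X].

(* [fset_set] is the empty set on an infinite argument; the complement of a
   tropical hypersurface has only finitely many components. *)
Definition mComp g : nat := #|` fset_set (components (~` trop_hypersurface g))|.

Definition fComp (m : nat) (g : 'I_m -> 'rV[R]_d -> R) : int :=
  \sum_(i < m) (mComp (g i))%:Z - (m%:Z - 1).

Definition polyhedron P : Prop :=
  exists (n : nat) (u : 'I_n -> 'rV[R]_d) (c : 'I_n -> R),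
    P = [set x | forall i, dotp (u i) x <= c i].

(* The case u = 0, c = 0 makes P a face of itself. *)
Definition face F P : Prop :=
  exists (u : 'rV[R]_d) (c : R),
    (forall x, P x -> dotp u x <= c) /\ F = P `&` [set x | dotp u x = c].

Definition indep_directions P (k : nat) : Prop :=
  exists s : k.-tuple 'rV[R]_d, free s /\
    forall i : 'I_k, exists x y, [/\ P x, P y & tnth s i = x - y].

(* Dimension of the affine hull of P, as the largest number of linearly
   independent differences of points of P; meaningful for nonempty P only. *)
Definition pdim P : nat := \max_(k < d.+1 | `[< indep_directions P k >]) k.

(* The empty set is not counted among the cells, so that every cell has a
   dimension between 0 and d. *)
Definition polyhedral_complex (K : {fset set 'rV[R]_d}) : Prop :=
  [/\ forall P, P \in K -> polyhedron P /\ P !=set0,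
      forall P F, P \in K -> face F P -> F !=set0 -> F \in K &
      forall P Q, P \in K -> Q \in K -> P `&` Q !=set0 ->
        face (P `&` Q) P /\ face (P `&` Q) Q].

Definition support (K : {fset set 'rV[R]_d}) : set 'rV[R]_d :=
  [set x | exists2 P, P \in K & P x].

Definition complex_euler_char (K : {fset set 'rV[R]_d}) : int :=
  \sum_(i < d.+1) (-1) ^+ i * (#|` [fset P in K | pdim P == i]|)%:Z.

(* The Euler characteristic of a set, computed on any polyhedral complex whose
   union it is; the value does not depend on that complex. The default 0 is
   only reached by sets that are not unions of polyhedral complexes. *)
Definition euler_char X : int :=
  xget 0 [set z | exists K : {fset set 'rV[R]_d},
    [/\ polyhedral_complex K, support K = X & z = complex_euler_char K]].

End TropicalHypersurfaces.

(* Main.v *)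
Require Import Defs.
From mathcomp Require Import ring lra.

(** Counting the faces of a polyhedral complex with signs [(-1)^dim] amounts to
    counting their pairwise disjoint relative interiors, and this count is
    additive on finite unions of relatively open polyhedra: cutting such a set
    by a hyperplane that meets it properly replaces [(-1)^k] by
    [(-1)^k + (-1)^(k-1) + (-1)^k].  The valuation so obtained equals [(-1)^d]
    on each nonempty linear region of a tropical polynomial, hence
    [(-1)^d * mComp g] on the complement of [V(g)].  By convexity, [V] of a sum
    is the union of the [V(g_i)], and the formula is inclusion-exclusion. *)

Set Implicit Arguments.
Unset Strict Implicit.
Unset Printing Implicit Defensive.

Import Order.TTheory GRing.Theory Num.Theory.
Import numFieldNormedType.Exports.

Local Open Scope classical_set_scope.
Local Open Scope ring_scope.

(** The obstacle is that [euler_char] is a choice: it is the count on some complex with the given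
    union, and two such complexes must be shown to agree. The count [eul H X] cuts the set [X]
    itself by a finite list [H] of hyperplanes and refers to no complex. It may vary with [H] while
    [H] is coarse, so the comparisons with [euler_char] are stated for every list containing a
    certain one; concatenation then makes finitely many of them hold together. Existence matters as
    well: an intersection of tropical hypersurfaces has to be the support of some complex, and the
    closed cells of the arrangement of all differences of terms provide one. Counting relatively
    open pieces is the Euler characteristic with compact supports, which is the origin of the factor
    [(-1)^d]. The empty intersection, that is the whole space, and the single hypersurfaces together
    produce [fComp]. *)

Section AffineForms.
Variables (R : realType) (d : nat).
Notation V := 'rV[R]_d.
Implicit Types (u v x y : V) (h p q : V * R) (H : seq (V * R)).

Lemma dotpDl u v x : dotp (u + v) x = dotp u x + dotp v x.
Proof. by rewrite /dotp -big_split; apply: eq_bigr => j _; rewrite !mxE mulrDl. Qed.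

Lemma dotpDr u x y : dotp u (x + y) = dotp u x + dotp u y.
Proof. by rewrite /dotp -big_split; apply: eq_bigr => j _; rewrite !mxE mulrDr. Qed.

Lemma dotpZl (t : R) u x : dotp (t *: u) x = t * dotp u x.
Proof. by rewrite /dotp mulr_sumr; apply: eq_bigr => j _; rewrite !mxE mulrA. Qed.

Lemma dotpZr (t : R) u x : dotp u (t *: x) = t * dotp u x.
Proof. by rewrite /dotp mulr_sumr; apply: eq_bigr => j _; rewrite !mxE; ring. Qed.

Lemma dotpNl u x : dotp (- u) x = - dotp u x.
Proof. by rewrite -scaleN1r dotpZl mulN1r. Qed.

Lemma dotpNr u x : dotp u (- x) = - dotp u x.
Proof. by rewrite -scaleN1r dotpZr mulN1r. Qed.

Lemma dotp0l x : dotp (0 : V) x = 0.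
Proof. by rewrite -(scale0r (0 : V)) dotpZl mul0r. Qed.

Lemma dotpBl u v x : dotp (u - v) x = dotp u x - dotp v x.
Proof. by rewrite dotpDl dotpNl. Qed.

Lemma dotpBr u x y : dotp u (x - y) = dotp u x - dotp u y.
Proof. by rewrite dotpDr dotpNr. Qed.

Lemma dotp_eq0 u : dotp u u = 0 -> u = 0.
Proof.
move=> /eqP; rewrite /dotp psumr_eq0; last by move=> j _; rewrite -expr2 sqr_ge0.
move=> /allP u0; apply/rowP => j; have := u0 j; rewrite mem_index_enum => /(_ isT).
by rewrite /= -expr2 sqrf_eq0 mxE => /eqP.
Qed.

Lemma dotp_ge0 u : 0 <= dotp u u.
Proof. by apply: sumr_ge0 => j _; rewrite -expr2 sqr_ge0. Qed.

Definition ev h x : R := dotp h.1 x + h.2.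

Lemma evD p q x : ev (p + q) x = ev p x + ev q x.
Proof. by rewrite /ev /= dotpDl; ring. Qed.

Lemma evN p x : ev (- p) x = - ev p x.
Proof. by rewrite /ev /= dotpNl; ring. Qed.

Lemma evB p q x : ev (p - q) x = ev p x - ev q x.
Proof. by rewrite evD evN. Qed.

Lemma evZ (t : R) p x : ev (t *: p) x = t * ev p x.
Proof. by rewrite /ev /= dotpZl mulrDr. Qed.

Lemma ev_shift h x v (t : R) : ev h (x + t *: v) = ev h x + t * dotp h.1 v.
Proof. by rewrite /ev dotpDr dotpZr; ring. Qed.

Lemma ev_conv h x y (t : R) :
  ev h (x + t *: (y - x)) = (1 - t) * ev h x + t * ev h y.
Proof. by rewrite ev_shift dotpBr /ev; ring. Qed.

Lemma ev_opp_conv h x y (t : R) :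
  ev h (x + t *: (x - y)) = (1 + t) * ev h x - t * ev h y.
Proof. by rewrite ev_shift dotpBr /ev; ring. Qed.

Lemma small_shift H x v : exists2 e : R, 0 < e & forall t, `|t| <= e ->
  forall h, h \in H -> (0 < ev h x -> 0 < ev h (x + t *: v)) /\
                       (ev h x < 0 -> ev h (x + t *: v) < 0).
Proof.
elim: H => [|h H [e e0 He]]; first by exists 1.
have [h0|h0] := eqVneq (ev h x) 0.
  exists e => // t te k; rewrite inE => /orP[/eqP->|]; last exact: He.
  by rewrite h0 ltxx.
(* The [+ 1] keeps the denominator positive when [h] is constant along [v], and makes the bound on
   the variation strict. *)
pose a := `|ev h x| / (`|dotp h.1 v| + 1).
have a0 : 0 < a by rewrite divr_gt0 ?normr_gt0// ltr_wpDl.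
exists (Num.min e a); first by rewrite lt_min e0 a0.
move=> t; rewrite le_min => /andP[te ta] k; rewrite inE => /orP[/eqP->|]; last exact: He.
rewrite ev_shift.
have : `|t * dotp h.1 v| < `|ev h x|.
  rewrite normrM (@le_lt_trans _ _ (a * `|dotp h.1 v|)) ?ler_wpM2r//.
  rewrite /a mulrAC ltr_pdivrMr ?ltr_wpDl//.
  by rewrite ltr_pM2l ?normr_gt0// ltrDl ltr01.
by move=> A; split => B; move: A; [rewrite (gtr0_norm B)|rewrite (ltr0_norm B)];
  rewrite ltr_norml => /andP[]; lra.
Qed.

End AffineForms.

(** * Relatively open convex cells and their signed count under cuts *)

Section Cells.
Variables (R : realType) (d : nat).
Notation V := 'rV[R]_d.
Implicit Types (x y v : V) (h : V * R) (H : seq (V * R)) (X : set V) (U : {vspace V}).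

(** One point with room in every direction of [U] is enough: shrunken basis vectors of [U] are then
    differences from it. This serves relatively open cells and closed polyhedra alike. *)
Lemma pdimE X U : (forall x y, X x -> X y -> x - y \in U) ->
  (exists2 x, X x & forall v, v \in U -> exists2 e : R, 0 < e & X (x + e *: v)) ->
  pdim X = \dim U.
Proof.
move=> XU [x Xx XxU]; apply/eqP; rewrite eqn_leq; apply/andP; split.
  apply/bigmax_leqP => k /asboolP[s [fs sX]].
  have := fs; rewrite /free size_tuple => /eqP <-; apply: dimvS.
  apply/span_subvP => v /tnthP[i ->].
  by have [y [z [Xy Xz ->]]] := sX i; exact: XU.
have dU : (\dim U < d.+1)%N.
  by rewrite ltnS (leq_trans (dimvS (subvf U)))// dimvf /dim /= mul1n.
apply: (@leq_bigmax_cond _ _ (fun k : 'I_d.+1 => k : nat) (Ordinal dU)).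
apply/asboolP.
have He (i : 'I_(\dim U)) : {e : R | 0 < e & X (x + e *: tnth (vbasis U) i)}.
  by apply: cid2; exact/XxU/vbasis_mem/mem_tnth.
have [e e0 Xe] : exists2 e : 'I_(\dim U) -> R, forall i, 0 < e i &
    forall i, X (x + e i *: tnth (vbasis U) i).
  by exists (fun i => s2val (He i)) => i; [case: (He i)|case: (He i)].
exists [tuple e i *: tnth (vbasis U) i | i < \dim U]; split; last first.
  move=> i; exists (x + e i *: tnth (vbasis U) i), x.
  by split => //; rewrite tnth_mktuple addrAC subrr add0r.
apply/freeP => k; under eq_bigr => i _.
  rewrite (_ : _`_i = e i *: (vbasis U)`_i) ?scalerA; last first.
    by rewrite -[in LHS]tnth_nth tnth_mktuple (tnth_nth 0).
over.
have /freeP bf : free (vbasis U) := basis_free (vbasisP U).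
move=> /(bf (fun i => k i * e i)) k0 i; have /eqP := k0 i.
by rewrite mulf_eq0 (gt_eqF (e0 i)) orbF => /eqP.
Qed.

(* A nonempty convex set, relatively open in a translate of U. *)
Record cell U X : Prop := Cell {
  cell_nonempty : X !=set0;
  cell_convex : forall x y (t : R), X x -> X y -> 0 <= t <= 1 -> X (x + t *: (y - x));
  cell_dir : forall x y, X x -> X y -> x - y \in U;
  cell_open : forall x v, X x -> v \in U ->
    exists2 e : R, 0 < e & forall t, `|t| <= e -> X (x + t *: v) }.

Lemma cell_pdim U X : cell U X -> pdim X = \dim U.
Proof.
move=> [[x Xx] _ Xd Xo]; apply: pdimE => //; exists x => // v /(Xo x v Xx)[e e0 He].
by exists e => //; apply: He; rewrite gtr0_norm.
Qed.

(** The directions of [U] parallel to the hyperplane of [h]; the linear map is [dotp h.1] with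
    values in 1 x 1 matrices. *)
Definition sub_kernel U h : {vspace V} := (U :&: lker (linfun (mulmxr h.1^T)))%VS.

Lemma mem_sub_kernel U h v :
  (v \in sub_kernel U h) = (v \in U) && (dotp h.1 v == 0).
Proof.
rewrite /sub_kernel memv_cap memv_ker lfunE /=; congr (_ && _).
have -> : dotp h.1 v = (v *m h.1^T) 0 0.
  by rewrite mxE /dotp; apply: eq_bigr => j _; rewrite !mxE mulrC.
by apply/eqP/eqP => [->|vh]; [rewrite mxE|apply/matrixP => i j; rewrite !ord1 vh mxE].
Qed.

Lemma dim_sub_kernel U h v : v \in U -> dotp h.1 v != 0 ->
  \dim U = (\dim (sub_kernel U h)).+1.
Proof.
move=> vU hv; rewrite -(limg_ker_dim (linfun (mulmxr h.1^T)) U) -[RHS]addn1.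
congr (_ + _)%N; apply/eqP; rewrite eqn_leq; apply/andP; split.
  by rewrite (leq_trans (dimvS (subvf _)))// dimvf /dim /= muln1.
rewrite lt0n dimv_eq0; apply/negP => /eqP W0.
have : linfun (mulmxr h.1^T) v \in 0%VS by rewrite -W0 memv_img.
rewrite memv0 -memv_ker => vk; move: hv.
by have := mem_sub_kernel U h v; rewrite memv_cap vk vU => /esym /= ->.
Qed.

Definition pos h : set V := [set x | 0 < ev h x].
Definition neg h : set V := [set x | ev h x < 0].
Definition zer h : set V := [set x | ev h x = 0].

Lemma cell_pos U X h : cell U X -> (X `&` pos h) !=set0 -> cell U (X `&` pos h).
Proof.
move=> [_ Xc Xd Xo] X0; split => //.
- move=> x y t [Xx xh] [Xy yh] t01; split; first exact: Xc.
  by move: xh yh; rewrite /pos /= ev_conv => xh yh; nra.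
- by move=> x y [Xx _] [Xy _]; exact: Xd.
- move=> x v [Xx xh] /(Xo x v Xx)[e e0 He].
  have [e' e'0 He'] := small_shift [:: h] x v.
  exists (Num.min e e'); first by rewrite lt_min e0.
  move=> t; rewrite le_min => /andP[te te']; split; first exact: He.
  by apply: (He' t te' h _).1 => //; rewrite inE.
Qed.

Lemma pos_opp h : pos (- h) = neg h.
Proof. by apply/seteqP; split => x; rewrite /pos /neg /= evN oppr_gt0. Qed.

Lemma cell_neg U X h : cell U X -> (X `&` neg h) !=set0 -> cell U (X `&` neg h).
Proof. by rewrite -pos_opp; exact: cell_pos. Qed.

Lemma cell_zer U X h : cell U X -> (X `&` zer h) !=set0 ->
  cell (sub_kernel U h) (X `&` zer h).
Proof.
move=> [_ Xc Xd Xo] X0; split => //.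
- move=> x y t [Xx xh] [Xy yh] t01; split; first exact: Xc.
  by move: xh yh; rewrite /zer /= ev_conv => -> ->; ring.
- move=> x y [Xx xh] [Xy yh]; rewrite mem_sub_kernel Xd//=.
  by move: xh yh; rewrite /zer /ev /= dotpBr => xh yh; apply/eqP; lra.
- move=> x v [Xx xh]; rewrite mem_sub_kernel => /andP[vU /eqP vh].
  have [e e0 He] := Xo x v Xx vU; exists e => // t te; split; first exact: He.
  by rewrite /zer /= ev_shift vh xh; ring.
Qed.

(** The test is there because [pdim set0] is 0, which would make the empty set count for 1. *)
Definition leaf X : int := if `[< X !=set0 >] then (-1) ^+ pdim X else 0.

Lemma leaf0 : leaf set0 = 0.
Proof. by rewrite /leaf; case: asboolP => // -[x]. Qed.

Lemma leaf_cell U X : cell U X -> leaf X = (-1) ^+ \dim U.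
Proof.
by move=> XU; rewrite /leaf (cell_pdim XU) asboolT//; exact: cell_nonempty XU.
Qed.

Lemma leaf_split U X h : cell U X ->
  leaf X = leaf (X `&` pos h) + leaf (X `&` zer h) + leaf (X `&` neg h).
Proof.
move=> XU; have [[x0 Xx0] Xc Xd Xo] := XU.
have [[z [Xz zh]]|Z0] := pselect ((X `&` zer h) !=set0); last first.
  have nz x : X x -> ev h x != 0.
    by move=> Xx; apply/eqP => xh; apply: Z0; exists x.
  (* The hyperplane misses [X]. Points on both sides would be joined by a segment inside [X] that
     crosses it; [t] is the crossing time. *)
  have same x y : X x -> X y -> 0 < ev h x -> ev h y < 0 -> False.
    move=> Xx Xy xh yh; pose t := ev h x / (ev h x - ev h y).
    have D : 0 < ev h x - ev h y by lra.
    apply: Z0; exists (x + t *: (y - x)); split.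
      apply: Xc => //; apply/andP; split; first by rewrite divr_ge0 ?ltW.
      by rewrite ler_pdivrMr// mul1r; lra.
    by rewrite /zer /= ev_conv /t; field; rewrite gt_eqF.
  have -> : X `&` zer h = set0.
    by apply/seteqP; split => // x [Xx xh]; apply: Z0; exists x.
  have [h0|h0|h0] := ltgtP (ev h x0) 0; last by have := nz _ Xx0; rewrite h0 eqxx.
  - have -> : X `&` pos h = set0.
      by apply/seteqP; split => // x [Xx xh]; exact: (same x x0).
    rewrite (_ : X `&` neg h = X) ?leaf0 ?add0r//.
    apply/seteqP; split => [x []//|x Xx]; split => //; rewrite /neg /=.
    by have := nz _ Xx; case: ltgtP => // xh _; case: (same x x0).
  - have -> : X `&` neg h = set0.
      by apply/seteqP; split => // x [Xx xh]; exact: (same x0 x).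
    rewrite (_ : X `&` pos h = X) ?leaf0 ?addr0//.
    apply/seteqP; split => [x []//|x Xx]; split => //; rewrite /pos /=.
    by have := nz _ Xx; case: ltgtP => // xh _; case: (same x0 x).
(* The hyperplane meets [X] at [z]. Either it contains [X], or some direction [v] of [U] is
   transversal and short moves from [z] along [v] and [- v] reach both sides. *)
have [[v [vU hv]]|hU] := pselect (exists v, v \in U /\ dotp h.1 v != 0); last first.
  have XZ : X `<=` zer h.
    move=> x Xx; rewrite /zer /=; have := Xd _ _ Xx Xz => xzU.
    have : dotp h.1 (x - z) = 0 by apply: contrapT => /eqP D; apply: hU; exists (x - z).
    by move: zh; rewrite /zer /ev /= dotpBr; lra.
  have -> : X `&` pos h = set0.
    by apply/seteqP; split => // x [/XZ]; rewrite /zer /pos /= => ->; rewrite ltxx.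
  have -> : X `&` neg h = set0.
    by apply/seteqP; split => // x [/XZ]; rewrite /zer /neg /= => ->; rewrite ltxx.
  by rewrite (setIidl XZ) leaf0 add0r addr0.
wlog hv0 : v vU hv / 0 < dotp h.1 v.
  move=> W; move: (hv); rewrite neq_lt => /orP[hv0|]; last exact: W.
  by apply: (W (- v)); rewrite ?memvN// dotpNr ?oppr_eq0 ?oppr_gt0.
have [e e0 He] := Xo z v Xz vU.
have P : cell U (X `&` pos h).
  apply: cell_pos => //; exists (z + e *: v); split; first by apply: He; rewrite gtr0_norm.
  by rewrite /pos /= ev_shift zh add0r mulr_gt0.
have N : cell U (X `&` neg h).
  apply: cell_neg => //; exists (z + (- e) *: v); split.
    by apply: He; rewrite normrN gtr0_norm.
  by rewrite /neg /= ev_shift zh add0r mulNr oppr_lt0 mulr_gt0.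
have Z : cell (sub_kernel U h) (X `&` zer h) by apply: cell_zer => //; exists z.
rewrite (leaf_cell XU) (leaf_cell P) (leaf_cell N) (leaf_cell Z).
by rewrite (dim_sub_kernel vU hv) exprS; rewrite mulN1r addNr add0r.
Qed.

(* X is cut along the hyperplanes of H and each nonempty piece counts as a single
   cell. The value is independent of H once H is fine enough to separate the
   relatively open cells of which X is made. *)
Fixpoint eul H X : int :=
  if H is h :: H' then eul H' (X `&` pos h) + eul H' (X `&` zer h) + eul H' (X `&` neg h)
  else leaf X.

Lemma eul0 H : eul H set0 = 0.
Proof. by elim: H => [|h H IH] /=; rewrite ?leaf0// !set0I IH. Qed.

Lemma eul_cell H U X : cell U X -> eul H X = (-1) ^+ \dim U.
Proof.
move=> XU; rewrite -(leaf_cell XU); move: U XU; elim: H X => [//|h H IH] X U XU /=.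
rewrite (leaf_split h XU); congr (_ + _ + _).
- have [X0|] := pselect (X `&` pos h !=set0); first exact: IH (cell_pos XU X0).
  by move=> /nonemptyPn ->; rewrite eul0 leaf0.
- have [X0|] := pselect (X `&` zer h !=set0); first exact: IH (cell_zer XU X0).
  by move=> /nonemptyPn ->; rewrite eul0 leaf0.
- have [X0|] := pselect (X `&` neg h !=set0); first exact: IH (cell_neg XU X0).
  by move=> /nonemptyPn ->; rewrite eul0 leaf0.
Qed.

Definition sign_separated H (A B : set V) := forall x y, A x -> B y ->
  exists2 h, h \in H & Num.sg (ev h x) != Num.sg (ev h y).

Lemma sign_separatedS H H' A B : {subset H <= H'} -> sign_separated H A B -> sign_separated H' A B.
Proof. by move=> HH' s x y Ax By; have [h /HH' hH hs] := s x y Ax By; exists h. Qed.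

(** Inside a region where [h] has constant sign, [h] separates nothing, so the rest of the list must
    do it. *)
Lemma sign_separatedI h H (A B : set V) (C : set V) :
  (forall x y, C x -> C y -> Num.sg (ev h x) = Num.sg (ev h y)) ->
  sign_separated (h :: H) A B -> sign_separated H (A `&` C) (B `&` C).
Proof.
move=> Ch s x y [Ax Cx] [By Cy]; have [k] := s x y Ax By.
rewrite inE => /orP[/eqP->|kH ks]; last by exists k.
by rewrite (Ch x y)// eqxx.
Qed.

(** Once all cuts are made, separation by the empty list means that one of the two pieces is
    empty. *)
Lemma eulU H A B : sign_separated H A B -> eul H (A `|` B) = eul H A + eul H B.
Proof.
elim: H A B => [|h H IH] A B s /=.
  have [[x Ax]|/nonemptyPn ->] := pselect (A !=set0); last by rewrite set0U leaf0 add0r.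
  have [[y By]|/nonemptyPn ->] := pselect (B !=set0); last by rewrite setU0 leaf0 addr0.
  by have [] := s x y Ax By.
rewrite !setIUl !IH; first by ring.
- by apply: sign_separatedI s => x y; rewrite /neg /= => ? ?; rewrite !ltr0_sg.
- by apply: sign_separatedI s => x y; rewrite /zer /= => -> ->.
- by apply: sign_separatedI s => x y; rewrite /pos /= => ? ?; rewrite !gtr0_sg.
Qed.

Lemma eul_bigcup H (I : eqType) (r : seq I) (A : I -> set V) : uniq r ->
  {in r &, forall i j, i != j -> sign_separated H (A i) (A j)} ->
  eul H [set x | exists2 i, i \in r & A i x] = \sum_(i <- r) eul H (A i).
Proof.
elim: r => [|i r IH] /=.
  move=> _ _; rewrite big_nil (_ : mkset _ = set0) ?eul0//.
  by apply/seteqP; split => x // [].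
move=> /andP[ir ur] s; rewrite big_cons -IH//; last first.
  by move=> j k jr kr; apply: s; rewrite inE ?jr ?kr orbT.
rewrite -eulU; last first.
  move=> x y Ax [j jr Ay]; apply: (s i j) => //; rewrite ?inE ?eqxx ?jr ?orbT//.
  by apply: contraNneq ir => ->.
congr eul; apply/seteqP; split => x.
  by move=> [j]; rewrite inE => /orP[/eqP ->|jr] Ax; [left|right; exists j].
move=> [Ax|[j jr Ax]]; first by exists i; rewrite ?inE ?eqxx.
by exists j; rewrite ?inE ?jr ?orbT.
Qed.

End Cells.

(** * Relative interiors, polyhedral complexes and hyperplane arrangements *)

Section Complexes.
Variables (R : realType) (d : nat).
Notation V := 'rV[R]_d.
Implicit Types (x y z v : V) (h p : V * R) (s H : seq (V * R)) (P Q F X : set V).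
Implicit Types (U : {vspace V}) (K : {fset set V}).

Lemma ev_sum (I : Type) (r : seq I) (C : pred I) (p : I -> V * R) x :
  ev (\sum_(i <- r | C i) p i) x = \sum_(i <- r | C i) ev (p i) x.
Proof.
apply: (big_morph (fun p => ev p x)) => [p1 p2|]; first exact: evD.
by rewrite /ev /= dotp0l addr0.
Qed.

Definition halfspaces s : set V := [set x | forall h, h \in s -> ev h x <= 0].

Lemma polyhedronP P : polyhedron P -> exists s, P = halfspaces s.
Proof.
move=> [n [u [c ->]]]; exists [seq (u i, - c i) | i <- enum 'I_n].
apply/seteqP; split => x /= xP.
  by move=> _ /mapP[i _ ->]; rewrite /ev /= subr_le0.
move=> i; have := xP (u i, - c i); rewrite /ev /= subr_le0; apply.
by apply/mapP; exists i; rewrite // mem_enum.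
Qed.

Lemma polyhedron_halfspaces s : polyhedron (halfspaces s).
Proof.
exists (size s), (fun i => (nth 0 s i).1), (fun i => - (nth 0 s i).2).
apply/seteqP; split => x /= xP.
  by move=> i; have := xP _ (mem_nth 0 (ltn_ord i)); rewrite /ev; lra.
by move=> h /(nthP 0)[i si <-]; have := xP (Ordinal si); rewrite /ev /=; lra.
Qed.

Lemma faceP F P : face F P <->
  exists2 p, (forall x, P x -> ev p x <= 0) & F = P `&` zer p.
Proof.
split=> [[u [c [Pu ->]]]|[p Pp ->]].
  exists (u, - c); first by move=> x /Pu; rewrite /ev /=; lra.
  by congr (_ `&` _); apply/seteqP; split => x; rewrite /zer /ev /=; lra.
exists p.1, (- p.2); split; first by move=> x /Pp; rewrite /ev /=; lra.
by congr (_ `&` _); apply/seteqP; split => x; rewrite /zer /ev /=; lra.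
Qed.

(** For a polyhedron this is the relative interior, described without the affine hull: segments of
    [P] ending at [x] can be prolonged beyond [x]. *)
Definition relint P : set V := [set x | P x /\
  forall y, P y -> exists2 e : R, 0 < e & P (x + e *: (x - y))].

(** A form that is nonpositive on [P], zero at [x] and negative at [y] would be positive just beyond
    [x] on the line from [y]. *)
Lemma face_relint P F x : face F P -> relint P x -> F x -> F = P.
Proof.
move=> /faceP[p Pp ->] [Px Px'] [_ xp]; apply/seteqP; split => [y []//|y Py].
split => //; have [e e0 /Pp] := Px' y Py; have := Pp y Py; move: xp.
by rewrite /zer /= ev_opp_conv => ->; nra.
Qed.

Lemma halfspaces_extend s x y : halfspaces s x ->
  (forall h, h \in s -> ev h x = 0 -> ev h y = 0) ->
  exists2 e : R, 0 < e & halfspaces s (x + e *: (x - y)).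
Proof.
move=> sx sy; have [e e0 He] := small_shift s x (x - y).
exists e => // h hs; have := sx h hs; rewrite le_eqVlt => /orP[/eqP hx|hx].
  by rewrite ev_opp_conv hx (sy h hs hx); lra.
by apply/ltW/(He e _ h hs).2; rewrite // gtr0_norm.
Qed.

Lemma relint_halfspacesP s x : relint (halfspaces s) x <->
  halfspaces s x /\ forall h, h \in s -> ev h x = 0 -> forall y, halfspaces s y -> ev h y = 0.
Proof.
split=> [[sx rx]|[sx rx]]; split => //.
  move=> h hs hx y sy; have [e e0 /(_ h hs)] := rx y sy.
  by have := sy h hs; rewrite ev_opp_conv hx; nra.
by move=> y sy; apply: halfspaces_extend => // h hs hx; exact: rx.
Qed.

(* A point of F on as few of the hyperplanes of s as possible. *)
Lemma generic_point s F : F !=set0 -> F `<=` halfspaces s ->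
  (forall x y (t : R), F x -> F y -> 0 <= t <= 1 -> F (x + t *: (y - x))) ->
  exists2 x, F x & forall h, h \in s -> ev h x = 0 -> forall y, F y -> ev h y = 0.
Proof.
move=> [x0 Fx0] Fs Fc; pose f x := count (fun h => ev h x == 0) s.
have [n /asboolP[x Fx fx] nmin] := find_ex_minn
  (ex_intro (fun n => `[< exists2 x, F x & f x = n >]) _ (asboolT (ex_intro2 _ _ x0 Fx0 erefl))).
exists x => // h hs hx y Fy; apply: contrapT => hy.
(* All forms of [s] are nonpositive at [x] and [y], so one vanishing at the midpoint vanishes at
   both. Hence [z] avoids [h] and lies on strictly fewer hyperplanes than [x]. *)
pose z := x + 2^-1 *: (y - x).
have Fz : F z by apply: Fc => //; lra.
have hz : ev h z != 0 by apply/eqP; rewrite /z ev_conv hx => hz; apply: hy; lra.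
have /nmin : `[< exists2 x, F x & f x = f z >] by apply/asboolP; exists z.
rewrite -fx leqNgt => /negP; apply; rewrite /f -!size_filter.
have sub : subpred (fun k => (k \in s) && (ev k z == 0)) (fun k => ev k x == 0).
  move=> k /andP[ks /eqP]; have := Fs _ Fx k ks; have := Fs _ Fy k ks.
  by rewrite /z ev_conv => ? ? ?; apply/eqP; lra.
rewrite !size_filter.
have -> : count (fun k => ev k z == 0) s = count (fun k => (k \in s) && (ev k z == 0)) s.
  by apply: eq_in_count => k ->.
have /= := count_predUI (fun k => (k \in s) && (ev k z == 0)) (pred1 h) s.
have -> : count (predI (fun k => (k \in s) && (ev k z == 0)) (pred1 h)) s = 0%N.
  apply/eqP; rewrite -leqn0 leqNgt -has_count; apply/hasPn => k _ /=.
  by apply/negP => /andP[/andP[_ kz] /eqP kh]; move: hz; rewrite -kh kz.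
rewrite addn0 => E.
have h1 : (0 < count_mem h s)%N by rewrite -has_count has_pred1.
rewrite -(ltn_add2r (count_mem h s)) -E.
apply: (@leq_ltn_trans (count (fun k => ev k x == 0) s)).
  apply: sub_count => k /orP[/sub//|/eqP ->]; exact/eqP.
by rewrite -[X in (X < _)%N]addn0 ltn_add2l.
Qed.

Lemma halfspaces_convex s x y (t : R) : halfspaces s x -> halfspaces s y -> 0 <= t <= 1 ->
  halfspaces s (x + t *: (y - x)).
Proof. by move=> sx sy t01 h hs; rewrite ev_conv; have := sx h hs; have := sy h hs; nra. Qed.

Lemma relint_nonempty s : halfspaces s !=set0 -> relint (halfspaces s) !=set0.
Proof.
move=> s0; have [x sx xs] := @generic_point s _ s0 (@subset_refl _ _) (@halfspaces_convex s).
by exists x; apply/relint_halfspacesP.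
Qed.

(** By [relint_halfspacesP], the signs of the forms of [s] at a point decide whether it lies in the
    relative interior. *)
Lemma relint_separated s B : relint (halfspaces s) `&` B = set0 ->
  sign_separated s (relint (halfspaces s)) B.
Proof.
move=> sB0 x y sx By; apply: contrapT => nsep.
have sg_xy h : h \in s -> Num.sg (ev h x) = Num.sg (ev h y).
  by move=> hs; apply: contrapT => /eqP ne; apply: nsep; exists h.
have zero_xy h : h \in s -> ev h y = 0 -> ev h x = 0.
  by move=> hs hy; apply/eqP; rewrite -sgr_eq0 sg_xy// hy sgr0.
suff : (relint (halfspaces s) `&` B) y by rewrite sB0.
split => //; move: sx => /relint_halfspacesP[sx rx]; apply/relint_halfspacesP; split.
  by move=> h hs; rewrite -sgr_le0 -sg_xy// sgr_le0 sx.
by move=> h hs /(zero_xy h hs); exact: rx.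
Qed.

Lemma relint_cell s : halfspaces s !=set0 ->
  exists2 U, cell U (relint (halfspaces s)) & pdim (halfspaces s) = \dim U.
Proof.
move=> /relint_nonempty[x0 rx0]; have /relint_halfspacesP[sx0 sx0'] := rx0.
(* The common kernel of the constraints active at [x0]. As [x0] is relatively interior, these vanish
   on the whole polyhedron, so [U] is the direction of its affine hull. *)
pose U := foldr (fun h U => if ev h x0 == 0 then sub_kernel U h else U) fullv s.
have UP v : reflect (forall h, h \in s -> ev h x0 = 0 -> dotp h.1 v = 0) (v \in U).
  apply: (iffP idP); rewrite {sx0 sx0' rx0}/U; elim: s => [|h s IH] //=.
  - case: ifPn => [/eqP h0|h0].
      rewrite mem_sub_kernel => /andP[/IH sv /eqP hv] k; rewrite inE.
      by move=> /orP[/eqP ->//|]; exact: sv.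
    move=> /IH sv k; rewrite inE => /orP[/eqP ->|]; last exact: sv.
    by move=> /eqP; rewrite (negbTE h0).
  - by move=> _; exact: memvf.
  - move=> sv; have /IH vU : forall k, k \in s -> ev k x0 = 0 -> dotp k.1 v = 0.
      by move=> k ks; apply: sv; rewrite inE ks orbT.
    case: ifPn => // /eqP h0; rewrite mem_sub_kernel vU /=.
    by apply/eqP/sv; rewrite ?mem_head.
have dirU x y : halfspaces s x -> halfspaces s y -> x - y \in U.
  move=> sx sy; apply/UP => h hs h0; have := sx0' h hs h0 x sx.
  by have := sx0' h hs h0 y sy; rewrite /ev dotpBr; lra.
have openU x v : relint (halfspaces s) x -> v \in U ->
    exists2 e : R, 0 < e & forall t, `|t| <= e -> relint (halfspaces s) (x + t *: v).
  move=> /relint_halfspacesP[sx rx] /UP vU; have [e e0 He] := small_shift s x v.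
  exists e => // t te.
  have E h : h \in s -> ev h x = 0 -> ev h (x + t *: v) = 0.
    by move=> hs hx; rewrite ev_shift hx (vU h hs (rx h hs hx _ sx0)) mulr0 addr0.
  have N h : h \in s -> ev h x != 0 -> ev h (x + t *: v) < 0.
    by move=> hs hx; apply: (He t te h hs).2; rewrite lt_neqAle hx sx.
  apply/relint_halfspacesP; split => [h hs|h hs].
    by have [/(E h hs) ->|/(N h hs)/ltW] := eqVneq (ev h x) 0.
  have [hx _|/(N h hs)] := eqVneq (ev h x) 0; first exact: rx.
  by move=> + H0; rewrite H0 ltxx.
exists U; last first.
  apply: pdimE => //; exists x0 => // v /(openU x0 v rx0)[e e0 He].
  by exists e => //; have [] := He e; rewrite ?gtr0_norm.
split => //; first by exists x0.
- move=> x y t /relint_halfspacesP[sx rx] /relint_halfspacesP[sy ry] t01.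
  apply/relint_halfspacesP; split; first exact: halfspaces_convex.
  move=> h hs; rewrite ev_conv => E z sz.
  have [hx|hx] := eqVneq (ev h x) 0; first exact: rx.
  have [hy|hy] := eqVneq (ev h y) 0; first exact: ry.
  have hx' : ev h x < 0 by rewrite lt_neqAle hx sx.
  have hy' : ev h y < 0 by rewrite lt_neqAle hy sy.
  by exfalso; move: E; nra.
- by move=> x y [sx _] [sy _]; exact: dirU.
Qed.

Lemma complex_euler_charE K :
  complex_euler_char K = \sum_(P <- K) (-1) ^+ pdim P.
Proof.
rewrite /complex_euler_char.
have Pd P : (pdim P < d.+1)%N.
  by rewrite /pdim; apply/bigmax_leqP => i _; rewrite -ltnS.
under eq_bigr => i _.
  rewrite (_ : (#|` _ |)%:Z = \sum_(P <- K) (pdim P == i)%:Z); last first.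
    rewrite card_fset_sum1 big_fset /= (big_morph Posz PoszD (erefl _)).
    by rewrite big_mkcond; apply: eq_bigr => P _; case: eqP.
  rewrite mulr_sumr.
over.
rewrite exchange_big /=; apply: eq_bigr => P _.
rewrite (bigD1 (Ordinal (Pd P)))//= eqxx mulr1 big1 ?addr0// => i iP.
rewrite (_ : (pdim P == i) = false) ?mulr0//.
by apply: contra_neqF iP => /eqP PE; apply: val_inj.
Qed.

(** The left side sees only the support; this is what will make the Euler characteristic independent
    of the complex. *)
Lemma euler_complex K : polyhedral_complex K ->
  exists H, forall H', {subset H <= H'} ->
    eul H' (support K) = complex_euler_char K.
Proof.
move=> [Kp Kf Ki].
have /choice[s Ks] : forall P, exists s, P \in K -> P = halfspaces s.
  move=> P; have [/Kp[/polyhedronP[s ->] _]|PK] := boolP (P \in K); first by exists s.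
  by exists [::].
exists (flatten [seq s P | P <- K]) => H' HH'; rewrite complex_euler_charE.
have -> : support K = [set x | exists2 P, P \in enum_fset K & relint P x].
  apply/seteqP; split => x [P PK]; last by move=> [Px _]; exists P.
  move=> Px; have := Px; rewrite {1}(Ks P PK) => sx.
  (* A sum of nonpositive values vanishes only if each does, so [p] cuts out the smallest face of
     [P] through [x], and [x] is in its relative interior. *)
  pose p := \sum_(h <- s P | ev h x == 0) h.
  have pP y : P y -> ev p y <= 0.
    rewrite {1}(Ks P PK) ev_sum => sy; rewrite big_seq_cond.
    by apply: sumr_le0 => h /andP[/sy].
  have pz y : P y -> ev p y = 0 -> forall h, h \in s P -> ev h x = 0 -> ev h y = 0.
    rewrite {1}(Ks P PK) ev_sum => sy /eqP; rewrite -oppr_eq0 -sumrN big_seq_cond psumr_eq0.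
      move=> /allP E h hs hx; have := E h hs.
      by rewrite hs hx eqxx /= oppr_eq0 => /eqP.
    by move=> h /andP[/sy]; rewrite oppr_ge0.
  have px : ev p x = 0 by rewrite ev_sum big1// => h /eqP.
  exists (P `&` zer p).
    apply: (Kf P) => //; last by exists x.
    by apply/faceP; exists p.
  split => // y [Py /(pz y Py) py].
  have [e e0] := halfspaces_extend sx py; rewrite -(Ks P PK) => Pe; exists e => //.
  split => //; rewrite /zer /= ev_sum big_seq_cond big1// => h /andP[hs /eqP hx].
  by rewrite ev_opp_conv hx (py h hs hx); lra.
rewrite eul_bigcup//.
  apply: eq_big_seq => P PK; have [_ P0] := Kp P PK.
  move: P0; rewrite (Ks P PK) => /relint_cell[U cU ->]; exact: eul_cell.
move=> P Q PK QK PQ; apply: (@sign_separatedS _ _ (s P)).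
  by move=> h hs; apply: HH'; apply/flattenP; exists (s P) => //; exact: map_f.
have := @relint_separated (s P) (relint Q); rewrite -(Ks P PK); apply.
apply/seteqP; split => // x [Px Qx].
have PQx : (P `&` Q) x by split; [case: Px|case: Qx].
have [|fP fQ] := Ki P Q PK QK; first by exists x.
(* The common face contains a relatively interior point of both cells, so it equals both. *)
by move/eqP: PQ; apply; exact: etrans (esym (face_relint fP Px PQx)) (face_relint fQ Qx PQx).
Qed.

(** The closed cell of the arrangement with [x] in its relative interior: a form keeps its sign or
    becomes 0, and stays 0 where it is 0 at [x]. *)
Definition closed_cell H x : set V := [set y | forall h, h \in H ->
  (0 <= ev h x -> 0 <= ev h y) /\ (ev h x <= 0 -> ev h y <= 0)].

(* X is a union of closed cells of the arrangement H. *)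
Definition closed_for H X := forall x y, X x -> closed_cell H x y -> X y.

Lemma closed_cell_sg H x y :
  (forall h, h \in H -> Num.sg (ev h x) = Num.sg (ev h y)) -> closed_cell H x y.
Proof.
move=> sxy h hH.
by rewrite -(sgr_ge0 (ev h x)) -(sgr_le0 (ev h x)) sxy// sgr_ge0 sgr_le0.
Qed.

Lemma closed_cell_halfspaces H x : closed_cell H x =
  halfspaces ([seq h <- H | ev h x <= 0] ++ [seq - h | h <- H & 0 <= ev h x]).
Proof.
apply/seteqP; split => y Hy h.
  rewrite mem_cat mem_filter => /orP[/andP[hx /Hy[_]]|/mapP[k]]; first exact.
  by rewrite mem_filter => /andP[kx /Hy[+ _]] ->; rewrite evN oppr_le0; exact.
move=> hH; split => hx.
  rewrite -oppr_le0 -evN; apply: Hy; rewrite mem_cat; apply/orP; right.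
  by apply: map_f; rewrite mem_filter hx.
by apply: Hy; rewrite mem_cat mem_filter hx hH.
Qed.

(** The point [y] is taken generic in [F]: the forms vanishing at [y] are those vanishing on all of
    [F]. *)
Lemma closed_cell_face H x F : face F (closed_cell H x) -> F !=set0 ->
  exists2 y, closed_cell H x y & F = closed_cell H y.
Proof.
move=> /faceP[p Pp FE] F0.
have [||y Fy gy] := @generic_point
    ([seq h <- H | ev h x <= 0] ++ [seq - h | h <- H & 0 <= ev h x]) F F0.
- by rewrite -closed_cell_halfspaces FE; exact: subIsetl.
- move=> z w t; rewrite FE => -[xz pz] [xw pw] t01; split.
    by move: xz xw; rewrite !closed_cell_halfspaces => xz xw; exact: halfspaces_convex.
  by move: pz pw; rewrite /zer /= ev_conv => -> ->; lra.
have [xy py] : (closed_cell H x `&` zer p) y by rewrite -FE.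
have zeroF h z : h \in H -> ev h y = 0 -> F z -> ev h z = 0.
  move=> hH hy Fz; have [hx|/ltW hx] := leP (ev h x) 0.
    by apply: gy => //; rewrite mem_cat mem_filter hx hH.
  apply/eqP; rewrite -oppr_eq0 -evN; apply/eqP; apply: gy => //; last by rewrite evN hy oppr0.
  by rewrite mem_cat map_f ?orbT// mem_filter hx.
exists y => //; apply/seteqP; split => z.
  move=> Fz h hH; have := Fz; rewrite FE => -[/(_ h hH)[xz xz'] _].
  have [hy|hy|hy] := ltgtP (ev h y) 0; last by rewrite (zeroF h z).
  - by split => // _; apply: xz'; rewrite leNgt; apply/negP => /ltW/(xy h hH).1; lra.
  - by split => // _; apply: xz; rewrite leNgt; apply/negP => /ltW/(xy h hH).2; lra.
move=> yz; have xz : closed_cell H x z.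
  move=> h hH; have [xy1 xy2] := xy h hH; have [yz1 yz2] := yz h hH.
  by split => [/xy1/yz1|/xy2/yz2].
rewrite FE; split => //.
(* The segment from [z] to [y] continues beyond [y] inside the cell of [x]. As [p] is nonpositive at
   both ends and 0 at [y], it is 0 at [z]. *)
have [||e e0] := @halfspaces_extend
    ([seq h <- H | ev h x <= 0] ++ [seq - h | h <- H & 0 <= ev h x]) y z.
- by rewrite -closed_cell_halfspaces.
- have zz h : h \in H -> ev h y = 0 -> ev h z = 0.
    move=> hH hy; have [] := yz h hH; rewrite hy lexx => /(_ isT) ? /(_ isT) ?; lra.
  move=> h; rewrite mem_cat mem_filter => /orP[/andP[_]|/mapP[k]]; first exact: zz.
  rewrite mem_filter => /andP[_ kH] -> /eqP; rewrite !evN oppr_eq0 => /eqP/(zz k kH) ->.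
  by rewrite oppr0.
rewrite -closed_cell_halfspaces => /Pp; have := Pp z xz; move: py.
by rewrite /zer /= ev_opp_conv => ->; nra.
Qed.

Lemma closed_cellI_face H x y : face (closed_cell H x `&` closed_cell H y) (closed_cell H x).
Proof.
pose D h := Num.sg (ev h x) != Num.sg (ev h y).
(* Each summand is nonpositive on the cell of [x]. A form with different signs at [x] and [y]
   vanishes on both cells at once, so [p] vanishes exactly on the intersection. *)
pose p := \sum_(h <- H | D h) (- Num.sg (ev h x)) *: h.
have pE z : ev p z = - \sum_(h <- H | D h) Num.sg (ev h x) * ev h z.
  by rewrite ev_sum -sumrN; apply: eq_bigr => h _; rewrite evZ mulNr.
have sgn z h : closed_cell H x z -> h \in H -> 0 <= Num.sg (ev h x) * ev h z.
  move=> xz hH; have [xz1 xz2] := xz h hH.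
  have [hx|hx|hx] := ltgtP (ev h x) 0; last by rewrite hx sgr0 mul0r.
  - by rewrite ltr0_sg// mulN1r oppr_ge0; apply/xz2/ltW.
  - by rewrite gtr0_sg// mul1r; apply/xz1/ltW.
apply/faceP; exists p.
  move=> z xz; rewrite pE oppr_le0 big_seq_cond; apply: sumr_ge0 => h /andP[hH _].
  exact: sgn.
apply/seteqP; split => z [xz] H2; split => //.
  rewrite /zer /= pE big_seq_cond big1 ?oppr0// => h /andP[hH Dh].
  have [xz1 xz2] := xz h hH; have [yz1 yz2] := H2 h hH; move: Dh; rewrite /D.
  case: (ltgtP (ev h x) 0) => hx; last by rewrite hx sgr0 mul0r.
    rewrite (ltr0_sg hx) => hy; suff -> : ev h z = 0 by rewrite mulr0.
    have : 0 <= ev h y by rewrite leNgt; apply: contraNN hy => /ltr0_sg ->.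
    by move=> /yz1; have := xz2 (ltW hx); lra.
  rewrite (gtr0_sg hx) => hy; suff -> : ev h z = 0 by rewrite mulr0.
  have : ev h y <= 0 by rewrite leNgt; apply: contraNN hy => /gtr0_sg ->.
  by move=> /yz2; have := xz1 (ltW hx); lra.
move: H2; rewrite /zer /= pE => /eqP; rewrite oppr_eq0 big_seq_cond psumr_eq0; last first.
  by move=> h /andP[hH _]; exact: sgn.
move=> /allP E h hH; have [xz1 xz2] := xz h hH.
have [Dh|] := boolP (D h).
  have := E h hH; rewrite hH Dh /= mulf_eq0 sgr_eq0 => /orP[/eqP hx|/eqP ->//].
  by move: xz1 xz2; rewrite hx lexx => /(_ isT) ? /(_ isT) ?; split => _.
by rewrite negbK => /eqP sxy; rewrite -sgr_ge0 -sgr_le0 -sxy sgr_ge0 sgr_le0.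
Qed.

Lemma closed_for_complex H X : closed_for H X ->
  exists2 K : {fset set V}, polyhedral_complex K & support K = X.
Proof.
move=> HX.
have fin : finite_set [set closed_cell H x | x in X].
  (* A closed cell depends only on this finite table of weak signs, so there are finitely many
     cells. *)
  pose code x := [ffun i : 'I_(size H) => (0 <= ev (nth 0 H i) x, ev (nth 0 H i) x <= 0)].
  pose G (c : {ffun 'I_(size H) -> bool * bool}) := [set y : V | forall i : 'I_(size H),
    ((c i).1 -> 0 <= ev (nth 0 H i) y) /\ ((c i).2 -> ev (nth 0 H i) y <= 0)].
  apply: (@sub_finite_set _ _ (G @` setT)); last exact/finite_image/finite_finset.
  move=> _ [x Xx <-]; exists (code x) => //; apply/seteqP; split => y Gy.
    by move=> h /(nthP 0)[i iH <-]; have := Gy (Ordinal iH); rewrite ffunE.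
  by move=> i; rewrite ffunE /=; apply: Gy; rewrite mem_nth.
have KP P : reflect (exists2 x, X x & closed_cell H x = P)
    (P \in fset_set [set closed_cell H x | x in X]).
  by rewrite in_fset_set//; apply: (iffP idP); rewrite inE.
exists (fset_set [set closed_cell H x | x in X]).
  split=> [P /KP[x Xx <-]|P F /KP[x Xx <-] /closed_cell_face fF /fF[y xy ->]|P Q].
  - by split; [rewrite closed_cell_halfspaces; exact: polyhedron_halfspaces|exists x].
  - by apply/KP; exists y => //; exact: HX xy.
  - move=> /KP[x Xx <-] /KP[y Xy <-] _; split; first exact: closed_cellI_face.
    by rewrite setIC; exact: closed_cellI_face.
apply/seteqP; split => [y [P /KP[x Xx <-]]|x Xx]; first exact: HX.
by exists (closed_cell H x) => //; apply/KP; exists x.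
Qed.

(** The choice in [euler_char] is harmless: two complexes with union [X] are compared on the
    concatenation of their lists. *)
Lemma euler_charE H X : closed_for H X ->
  exists H0, forall H', {subset H0 <= H'} -> eul H' X = euler_char X.
Proof.
move=> /closed_for_complex[K Kc KX]; have [H0 H0K] := euler_complex Kc.
exists H0 => H' /H0K; rewrite KX => ->.
apply/esym/xget_unique; first by exists K.
move=> _ [K' [K'c K'X ->]]; have [H1 H1K] := euler_complex K'c.
rewrite -(H0K (H0 ++ H1)) -?(H1K (H0 ++ H1)) ?KX ?K'X// => h hH.
  by rewrite mem_cat hH orbT.
by rewrite mem_cat hH.
Qed.

End Complexes.

(** * Inclusion-exclusion for the cut count *)

Section InclusionExclusion.
Variables (R : realType) (d : nat).
Notation V := 'rV[R]_d.
Implicit Types (x y : V) (H : seq (V * R)).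

Lemma sum_sign_subset (I : finType) (T : {set I}) :
  \sum_(S : {set I} | S \subset T) (-1) ^+ #|S| = (T == finset.set0)%:R :> int.
Proof.
(* The signed sum is the expansion of a product with factor [-1 + 1] for each [i] in [T] and [0 + 1]
   elsewhere. *)
have E := @bigA_distr int 0 1 *%R +%R I (fun i => if i \in T then -1 else 0) (fun=> 1).
rewrite big_mkcond /=.
transitivity (\prod_i ((if i \in T then -1 else 0) + 1) : int).
  rewrite E; apply: eq_bigr => S _; case: ifPn => [/fintype.subsetP ST|].
    rewrite -prodr_const big_mkcond /=; apply: eq_bigr => i _.
    by case: ifPn => // /ST ->.
  by move=> /fintype.subsetPn[i iS iT]; rewrite (bigD1 i)//= iS (negbTE iT) mul0r.
have [->|/set0Pn[i iT]] := eqVneq T finset.set0.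
  by rewrite big1// => i _; rewrite inE add0r.
by rewrite (bigD1 i)//= iT addNr mul0r.
Qed.

(** The space splits into atoms by the exact set [T] of indices [i] with [A i x]. Closedness makes
    membership depend on signs only, so atoms are separated; in the double sum only the atom of the
    empty [T] survives. *)
Lemma eul_inclusion_exclusion H (I : finType) (A : I -> set V) :
  (forall i, closed_for H (A i)) ->
  eul H [set x | forall i, ~ A i x] =
  \sum_(S : {set I}) (-1) ^+ #|S| * eul H (\bigcap_(i in [set` S]) A i).
Proof.
move=> cA; pose atom (T : {set I}) : set V := [set x | forall i, A i x <-> i \in T].
have sep T T' : T != T' -> sign_separated H (atom T) (atom T').
  move=> TT' x y xT yT'; apply: contrapT => nsep.
  have sxy h : h \in H -> Num.sg (ev h x) = Num.sg (ev h y).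
    by move=> hH; apply: contrapT => /eqP ne; apply: nsep; exists h.
  have xy : closed_cell H x y := closed_cell_sg sxy.
  have yx : closed_cell H y x by apply: closed_cell_sg => h /sxy.
  move/eqP: TT'; apply; apply/setP => i; apply/idP/idP.
    by move=> /xT Ax; apply/yT'; exact: cA xy.
  by move=> /yT' Ay; apply/xT; exact: cA yx.
have capE (S : {set I}) : eul H (\bigcap_(i in [set` S]) A i) =
    \sum_(T : {set I} | S \subset T) eul H (atom T).
  rewrite -big_filter -eul_bigcup; last 2 first.
  - by rewrite filter_uniq// index_enum_uniq.
  - by move=> T T' _ _; exact: sep.
  congr eul; apply/seteqP; split => x.
    move=> Ax; exists [set i | `[< A i x >]]%SET.
      rewrite mem_filter mem_index_enum andbT; apply/fintype.subsetP => i iS.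
      by rewrite inE; apply/asboolP; exact: Ax.
    by move=> i; rewrite inE; split => /asboolP.
  move=> [T]; rewrite mem_filter => /andP[/fintype.subsetP ST _] xT i iS.
  by apply/xT/ST.
under eq_bigr => S _ do rewrite capE mulr_sumr.
rewrite (exchange_big_dep xpredT)//=.
under eq_bigr => T _ do rewrite -mulr_suml sum_sign_subset.
rewrite (bigD1 finset.set0)//= eqxx mul1r big1 ?addr0; last first.
  by move=> T /negbTE ->; rewrite mul0r.
congr eul; apply/seteqP; split => x xA i.
  by split=> [Ax|]; [case: (xA i)|rewrite inE].
by move/(xA i); rewrite inE.
Qed.

End InclusionExclusion.

(** * Tropical polynomials, their linear regions and hypersurfaces *)

Section Tropical.
Variables (R : realType) (d : nat).
Notation V := 'rV[R]_d.
Implicit Types (x y v : V) (h p q : V * R) (s H : seq (V * R)) (g : V -> R).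

Lemma ev_continuous h : continuous (ev h).
Proof.
have sum_cont (r : seq 'I_d) : continuous (fun y => \sum_(j <- r) h.1 0 j * y 0 j).
  elim: r => [|j r IH].
    rewrite (_ : (fun y => _) = cst 0); first exact: cst_continuous.
    by apply/funext => y; rewrite big_nil.
  rewrite (_ : (fun y => _) = (fun y : V => h.1 0 j * y 0 j) \+
      (fun y => \sum_(j <- r) h.1 0 j * y 0 j)); last first.
    by apply/funext => y; rewrite big_cons.
  move=> y.
  exact: (cvgD (cvgM (cvg_cst (h.1 0 j)) (@coord_continuous R 1 d 0 j y)) (IH y)).
by move=> y; exact: (cvgD (sum_cont _ y) (cvg_cst h.2)).
Qed.

Lemma line_continuous x v : continuous (fun t : R => x + t *: v).
Proof.
move=> t; exact: (cvgD (cvg_cst x) (@scalel_continuous _ _ v t)).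
Qed.

Lemma convex_connected (X : set V) :
  (forall x y (t : R), X x -> X y -> 0 <= t <= 1 -> X (x + t *: (y - x))) ->
  connected X.
Proof.
move=> Xc; have [->|/set0P[x Xx]] := eqVneq X set0; first exact: connected0.
rewrite (_ : X = \bigcup_(y in X) ((fun t : R => x + t *: (y - x)) @` `[0, 1])).
  apply: bigcup_connected.
    by exists x => y Xy; exists 0; rewrite ?scale0r ?addr0//= in_itv /= lexx ler01.
  move=> y Xy; apply: connected_continuous_connected; first exact: segment_connected.
  by apply: continuous_subspaceT => t; exact: line_continuous.
apply/seteqP; split => [y Xy|_ [y Xy [t + <-]]].
  exists y => //; exists 1; first by rewrite /= in_itv /= ler01 lexx.
  by rewrite scale1r addrC subrK.
by rewrite /= in_itv => t01; exact: Xc.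
Qed.

Definition max_of s g := forall x,
  (exists2 p, p \in s & g x = ev p x) /\ forall p, p \in s -> ev p x <= g x.

Lemma max_of_tropical g : tropical_polynomial g -> exists s, max_of s g.
Proof.
move=> [n [b [a gE]]]; exists [seq (b i, a i) | i <- enum 'I_n.+1] => x.
rewrite gE; split; last first.
  move=> _ /mapP[i _ ->].
  exact: (@le_bigmax _ _ _ _ (fun i : 'I_n.+1 => dotp (b i) x + a i)).
have [i ->] : exists i : 'I_n.+1, \big[Num.max/dotp (b ord0) x + a ord0]_(i < n.+1)
    (dotp (b i) x + a i) = dotp (b i) x + a i.
  elim/big_ind: _ => [|u w [i ->] [j ->]|i _]; [by exists ord0| |by exists i].
  by rewrite maxEle; case: ifP => _; [exists j|exists i].
by exists (b i, a i) => //; apply: map_f; rewrite mem_enum.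
Qed.

(** Terms are compared by value, so a repetition in [s] does not empty the region. *)
Definition region s p : set V := [set x | forall q, q \in s -> q != p -> ev q x < ev p x].

(* For a convex g this midpoint condition characterises affineness near x, and
   unlike affineness it visibly passes from a sum of convex functions to its
   summands. *)
Definition flat g x := forall v, exists2 e : R, 0 < e &
  g (x + e *: v) + g (x - e *: v) <= 2 * g x.

Lemma affine_near_flat g x : affine_near g x -> flat g x.
Proof.
move=> [b [a gx]] v; have gx0 : g x = dotp b x + a by exact: nbhs_singleton gx.
have : \forall t \near (0 : R), g (x + t *: v) = dotp b (x + t *: v) + a.
  have := @line_continuous x v 0; rewrite /continuous_at scale0r addr0 => lc.
  exact: (lc _ gx).
move=> /nbhs_ballP[e /= e0 He]; exists (e / 2); first by rewrite divr_gt0.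
have e2 : `|e / 2| < e by rewrite gtr0_norm ?divr_gt0//; lra.
have -> : x - (e / 2) *: v = x + (- (e / 2)) *: v by rewrite scaleNr.
rewrite !He ?gx0 ?dotpDr ?dotpZr; last 2 first.
- by rewrite /ball /= sub0r opprK.
- by rewrite /ball /= sub0r normrN.
lra.
Qed.

Lemma max_of_mid s g x v (t : R) : max_of s g -> 2 * g x <= g (x + t *: v) + g (x - t *: v).
Proof.
move=> gs; have [[p ps ->] _] := gs x.
have := (gs (x + t *: v)).2 p ps; have := (gs (x - t *: v)).2 p ps.
by rewrite -scaleNr !ev_shift; lra.
Qed.

Lemma flat_region s g x : max_of s g -> flat g x -> exists2 p, p \in s & region s p x.
Proof.
move=> gs gx; have [[p ps gp] gmax] := gs x; exists p => // q qs qp.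
rewrite lt_neqAle -gp gmax// andbT; apply: contraNneq qp => gq.
(* If [q] ties with [p] at [x], using [q] forwards and [p] backwards along the difference of slopes
   gains [e] times its squared norm. Flatness makes the slopes equal, and the tie then makes the
   constants equal. *)
have [e e0] := gx (q.1 - p.1).
have := (gs (x + e *: (q.1 - p.1))).2 q qs.
have := (gs (x - e *: (q.1 - p.1))).2 p ps.
rewrite -scaleNr !ev_shift gq -gp => A B C.
have : e * (dotp q.1 (q.1 - p.1) - dotp p.1 (q.1 - p.1)) <= 0 by lra.
rewrite -dotpBl pmulr_rle0// => D.
have /dotp_eq0 E : dotp (q.1 - p.1) (q.1 - p.1) = 0.
  by apply/eqP; rewrite eq_le D dotp_ge0.
have qp1 : q.1 = p.1 by apply/eqP; rewrite -subr_eq0 E.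
apply/eqP; rewrite [q]surjective_pairing [p]surjective_pairing; congr pair => //.
by move: gq gp; rewrite /ev qp1; lra.
Qed.

Lemma region_near s p x : region s p x -> \forall y \near x, region s p y.
Proof.
elim: s => [|q s IH] sp; first by near=> y.
have /IH IHx : region s p x by move=> r rs; apply: sp; rewrite inE rs orbT.
have [qp|qp] := eqVneq q p.
  by near=> y => r; rewrite inE => /orP[/eqP ->|]; [rewrite qp eqxx|move: r; near: y].
have qx : 0 < ev (p - q) x by rewrite evB subr_gt0 sp ?mem_head.
have qn : \forall y \near x, 0 < ev (p - q) y by have /cvgr_gt/(_ _ qx) := @ev_continuous (p - q) x.
near=> y => r; rewrite inE => /orP[/eqP -> _|].
  by rewrite -subr_gt0 -evB; near: y.
by move: r; near: y.
Unshelve. all: by end_near. Qed.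

Lemma region_value s g p x : max_of s g -> p \in s -> region s p x -> g x = ev p x.
Proof.
move=> gs ps px; have [[q qs gq] gmax] := gs x.
have [<-//|qp] := eqVneq q p.
by have := px q qs qp; have := gmax p ps; rewrite gq => /le_lt_trans/[apply]; rewrite ltxx.
Qed.

Lemma region_affine_near s g p x : max_of s g -> p \in s -> region s p x -> affine_near g x.
Proof.
move=> gs ps px; exists p.1, p.2; have := region_near px.
by apply: filterS => y; exact: region_value.
Qed.

Lemma affine_nearP s g x : max_of s g ->
  affine_near g x <-> exists2 p, p \in s & region s p x.
Proof.
move=> gs; split => [/affine_near_flat|[p ps]]; first exact: flat_region.
exact: region_affine_near.
Qed.

Lemma trop_hypersurface_sum (m : nat) (g : 'I_m -> V -> R) :
  (forall i, tropical_polynomial (g i)) ->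
  ~` trop_hypersurface (fun x => \sum_(i < m) g i x) =
  [set x | forall i, ~ trop_hypersurface (g i) x].
Proof.
move=> gt; have /choice[s gs] : forall i, exists s, max_of s (g i).
  by move=> i; exact: max_of_tropical.
apply/seteqP; split => x; rewrite /trop_hypersurface /=.
  move=> /contrapT/affine_near_flat gx i; apply; apply/(affine_nearP _ (gs i)).
  apply: flat_region => // v; have [e e0 ge] := gx v; exists e => //.
  (* The other summands have nonnegative midpoint gaps, so the gap of [g i] is at most that of the
     sum. *)
  have : 0 <= \sum_(j < m | j != i)
      (g j (x + e *: v) + g j (x - e *: v) - 2 * g j x).
    by apply: sumr_ge0 => j _; rewrite subr_ge0; exact: max_of_mid (gs j).
  rewrite sumrB big_split /= -mulr_sumr.
  by move: ge; rewrite !(bigD1 i (P := xpredT))//=; lra.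
move=> gx; apply; have /choice[f fP] : forall i, exists p : V * R,
    \forall y \near x, g i y = ev p y.
  by move=> i; have /contrapT[b [a ?]] := gx i; exists (b, a).
exists (\sum_(i < m) f i).1, (\sum_(i < m) f i).2.
have : \forall y \near x, forall i, g i y = ev (f i) y.
  exact: (@filter_forall _ _ (fun i y => g i y = ev (f i) y) _ (nbhs_filter x)).
apply: filterS => y gy; rewrite -/(ev _ y) ev_sum; exact: eq_bigr.
Qed.

Definition differences s := [seq p - q | p <- s, q <- s].

(** If [p] strictly wins at a point of the closed cell of [x], no [q - p] is nonnegative at [x], so
    [p] already wins at [x]. *)
Lemma closed_for_trop_hypersurface s g H : max_of s g -> {subset differences s <= H} ->
  closed_for H (trop_hypersurface g).
Proof.
move=> gs sH x y; rewrite /trop_hypersurface /= !(affine_nearP _ gs) => nx xy.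
move=> [p ps py]; apply: nx; exists p => // q qs qp; rewrite ltNge; apply/negP => pq.
have /xy[+ _] : q - p \in H by apply/sH/allpairsP; exists (q, p).
by rewrite !evB !subr_ge0 => /(_ pq); rewrite leNgt py.
Qed.

Lemma region_convex s p x y (t : R) : region s p x -> region s p y -> 0 <= t <= 1 ->
  region s p (x + t *: (y - x)).
Proof.
move=> px py t01 q qs qp; rewrite -subr_gt0 -evB ev_conv.
have : 0 < ev (p - q) x by rewrite evB subr_gt0 px.
by have : 0 < ev (p - q) y by [rewrite evB subr_gt0 py]; nra.
Qed.

Lemma region_cell s p : region s p !=set0 -> cell fullv (region s p).
Proof.
move=> s0; split => //.
- exact: region_convex.
- by move=> *; exact: memvf.
- move=> x v px _; have [e e0 He] := small_shift [seq p - q | q <- s] x v.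
  exists e => // t te q qs qp; rewrite -subr_gt0 -evB.
  by apply: (He t te _ (map_f _ qs)).1; rewrite evB subr_gt0 px.
Qed.

Lemma region_disjoint s p q x : p \in s -> q \in s -> region s p x -> region s q x -> p = q.
Proof.
move=> ps qs px qx; apply/eqP/negPn/negP => pq.
have := qx p ps pq; rewrite eq_sym in pq.
by have := px q qs pq => /lt_trans/[apply]; rewrite ltxx.
Qed.

Lemma component_region s g p x : max_of s g -> p \in s -> region s p x ->
  connected_component (~` trop_hypersurface g) x = region s p.
Proof.
move=> gs ps px.
have RegV q : q \in s -> region s q `<=` ~` trop_hypersurface g.
  by move=> qs y qy; rewrite /trop_hypersurface /=; apply; exact: region_affine_near qy.
apply/seteqP; split; last first.
  by apply: connected_component_max => //; [exact: RegV|exact/convex_connected/region_convex].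
have openReg q : open (region s q) by rewrite openE => y; exact: region_near.
set C := connected_component _ _; suff : C `&` region s p = C by move=> <-; exact: subIsetr.
apply: (@component_connected _ (~` trop_hypersurface g) x).
- by exists x; split => //; apply: connected_component_refl; exact: RegV px.
- by exists (region s p).
(* Within the component, a region is the complement of the other open regions, hence closed as well
   as open. *)
- exists (~` \bigcup_(q in [set q | q \in s /\ q != p]) region s q).
    by apply: open_closedC; apply: bigcup_open => q _; exact: openReg.
  apply/seteqP; split => y [Cy yP]; split => //.
    by move=> [q [qs qp]] qy; move/eqP: qp; apply; exact: region_disjoint qy yP.
  have /connected_component_sub := Cy.
  rewrite /trop_hypersurface /= => /contrapT/(affine_nearP _ gs)[q qs qy].
  by have [<-//|qp] := eqVneq q p; exfalso; apply: yP; exists q.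
Qed.

Lemma eul_trop_compl s g H : max_of s g -> {subset differences s <= H} ->
  eul H (~` trop_hypersurface g) = (-1) ^+ d * (mComp g)%:Z.
Proof.
(* Without repetitions and empty regions, [r] is in bijection with the components. *)
move=> gs sH; pose r := [seq p <- undup s | `[< region s p !=set0 >]].
have rs p : p \in r -> p \in s by rewrite mem_filter mem_undup => /andP[].
have -> : ~` trop_hypersurface g = [set x | exists2 p, p \in r & region s p x].
  apply/seteqP; split => x; rewrite /trop_hypersurface /=.
    move=> /contrapT/(affine_nearP _ gs)[p ps px]; exists p => //.
    by rewrite mem_filter mem_undup ps andbT; apply/asboolP; exists x.
  by move=> [p /rs ps px]; apply; exact: region_affine_near px.
rewrite eul_bigcup; last 2 first.
- by rewrite filter_uniq// undup_uniq.
- move=> p q /rs ps /rs qs pq x y px qy; exists (p - q).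
    by apply/sH/allpairsP; exists (p, q).
  rewrite !evB gtr0_sg; last by rewrite subr_gt0 px// eq_sym.
  by rewrite ltr0_sg ?subr_lt0 ?qy// gt_eqF//; lra.
rewrite (eq_big_seq (fun=> (-1) ^+ d)); last first.
  move=> p; rewrite mem_filter => /andP[/asboolP/region_cell/eul_cell -> _].
  by rewrite dimvf /dim /= mul1n.
rewrite big_const_seq count_predT iter_addr_0 -mulr_natr; congr (_ * _).
rewrite natz; congr Posz.
have [F FE Fsize] : exists2 F : {fset set V}, F =i [seq region s p | p <- r] &
    #|` F| = size (undup [seq region s p | p <- r]).
  by exists (seq_fset tt [seq region s p | p <- r]); [exact: seq_fsetE|rewrite size_seq_fset].
rewrite /mComp; have -> : components (~` trop_hypersurface g) = [set` F].
  apply/seteqP; split => [_ [x + <-]|C] /=; rewrite FE.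
    rewrite /trop_hypersurface /= => /contrapT/(affine_nearP _ gs)[p ps px].
    rewrite (component_region gs ps px) map_f// mem_filter mem_undup ps andbT.
    by apply/asboolP; exists x.
  move=> /mapP[p]; rewrite mem_filter mem_undup => /andP[/asboolP[x px] ps] ->.
  exists x; last exact: component_region px.
  by move=> /=; apply; exact: region_affine_near px.
rewrite set_fsetK Fsize undup_id ?size_map// map_inj_in_uniq; last first.
  move=> p q; rewrite mem_filter mem_undup => /andP[/asboolP[x px] ps] /rs qs pq.
  by apply: (@region_disjoint s p q x) => //; rewrite -pq.
by rewrite filter_uniq// undup_uniq.
Qed.

(** The terms of a tropical product are the sums of terms of its factors; the empty product has the
    single term 0. *)
Lemma max_of_sum (I : Type) (r : seq I) (g : I -> V -> R) :
  (forall i, exists s, max_of s (g i)) -> exists s, max_of s (fun x => \sum_(i <- r) g i x).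
Proof.
move=> gs; elim: r => [|i r [s1 IH]].
  exists [:: 0] => x; rewrite big_nil; have e0 : ev 0 x = 0 by rewrite /ev /= dotp0l addr0.
  split; first by exists 0; rewrite ?mem_head.
  by move=> p; rewrite inE => /eqP ->; rewrite e0.
have [s2 gi] := gs i; exists [seq p + q | p <- s2, q <- s1] => x; rewrite big_cons.
have [[p ps2 ->] pmax] := gi x; have [[q qs1 ->] qmax] := IH x; split.
  by exists (p + q); rewrite ?evD//; apply/allpairsP; exists (p, q).
by move=> _ /allpairsP[[p' q'] [/= /pmax p's /qmax q's ->]]; rewrite evD lerD.
Qed.

Lemma cell_setT : cell fullv [set: V].
Proof.
split => //; first by exists 0.
  by move=> *; exact: memvf.
by move=> *; exists 1.
Qed.

End Tropical.

(** * Assembling the region counting formula *)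

Lemma closed_for_bigcap (R : realType) (d : nat) (I : Type) (P : set I)
    (A : I -> set 'rV[R]_d) H :
  (forall i, P i -> closed_for H (A i)) -> closed_for H (\bigcap_(i in P) A i).
Proof. by move=> cA x y Ax xy i Pi; apply: cA xy => //; exact: Ax. Qed.

Lemma closed_for_separated (R : realType) (d : nat) (X : set 'rV[R]_d) H :
  closed_for H X -> sign_separated H X (~` X).
Proof.
move=> cX x y Xx; apply: contra_notP => nsep; apply: cX Xx _; apply: closed_cell_sg => h hH.
by apply: contrapT => /eqP ne; apply: nsep; exists h.
Qed.

Theorem theorem11 (R : realType) (d m : nat) (hm : (0 < m)%N)
    (g : 'I_m -> 'rV[R]_d -> R) (hg : forall i : 'I_m, tropical_polynomial (g i)) :
  (mComp (fun x : 'rV[R]_d => \sum_(i < m) g i x))%:Z =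
    fComp g +
    \sum_(2 <= k < m.+1) (-1) ^+ (k + d) *
      \sum_(S : {set 'I_m} | #|S| == k)
        euler_char (\bigcap_(i in [set` S]) trop_hypersurface (g i)).
Proof.
have gr i : exists s, max_of s (g i) by exact: max_of_tropical.
have [sG Gs] := max_of_sum (index_enum 'I_m) gr.
have /choice[s gs] := gr.
pose H1 := flatten [seq differences (s i) | i <- enum 'I_m].
have sH1 i : {subset differences (s i) <= H1}.
  move=> h hs; apply/flattenP; exists (differences (s i)) => //.
  by apply: map_f; rewrite mem_enum.
pose E (S : {set 'I_m}) := euler_char (\bigcap_(i in [set` S]) trop_hypersurface (g i)).
have [f fP] : {f : {set 'I_m} -> seq ('rV[R]_d * R) &
    forall S H', {subset f S <= H'} ->
      eul H' (\bigcap_(i in [set` S]) trop_hypersurface (g i)) = E S}.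
  apply: (choice (P := fun (S : {set 'I_m}) H0 => forall H', {subset H0 <= H'} ->
      eul H' (\bigcap_(i in [set` S]) trop_hypersurface (g i)) = E S)) => S.
  apply: (@euler_charE _ _ H1); apply: closed_for_bigcap => i _.
  exact: closed_for_trop_hypersurface (gs i) (sH1 i).
(* One list fine enough for every [g i], for their sum and for every intersection. *)
pose H := H1 ++ differences sG ++ flatten (map f (enum {set 'I_m})).
have sH i : {subset differences (s i) <= H}.
  by move=> h /sH1; rewrite mem_cat => ->.
have EH (S : {set 'I_m}) : eul H (\bigcap_(i in [set` S]) trop_hypersurface (g i)) = E S.
  apply: fP => h hf; rewrite !mem_cat; apply/orP; right; apply/orP; right.
  by apply/flattenP; exists (f S) => //; apply: map_f; rewrite mem_enum.
have cl i : closed_for H (trop_hypersurface (g i)).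
  exact: closed_for_trop_hypersurface (gs i) (sH i).
pose a : int := (-1) ^+ d; have aa : a * a = 1 by rewrite -expr2 sqrr_sign.
have setTE : eul H setT = a.
  by rewrite (eul_cell _ (@cell_setT R d)) dimvf /dim /= mul1n.
have E0 : E finset.set0 = a.
  rewrite -EH (_ : \bigcap_(i in _) _ = setT)//.
  by apply/seteqP; split => // x _ i /=; rewrite inE.
(* A hypersurface is the whole space, of value [a], less its linear regions. *)
have E1 i : E [set i]%SET = a - a * (mComp (g i))%:Z.
  rewrite -(eul_trop_compl (gs i) (sH i)) -setTE -EH.
  rewrite -(setUv (trop_hypersurface (g i))) eulU; last exact: closed_for_separated.
  rewrite addrK; congr eul; apply/seteqP; split => x.
    by move=> /(_ i); apply; rewrite /= inE.
  by move=> xi j; rewrite /= inE => /eqP ->.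
have key : a * (mComp (fun x => \sum_(i < m) g i x))%:Z =
    \sum_(0 <= k < m.+1) (-1) ^+ k * \sum_(S : {set 'I_m} | #|S| == k) E S.
  have <- := @eul_trop_compl _ _ _ _ H Gs; last first.
    by move=> h hG; rewrite !mem_cat hG orbT.
  rewrite trop_hypersurface_sum// eul_inclusion_exclusion//.
  under eq_bigr => S _ do rewrite EH.
  rewrite (partition_big (fun S : {set 'I_m} => inord #|S| : 'I_m.+1) xpredT)//= big_mkord.
  apply: eq_bigr => k _; rewrite mulr_sumr.
  have cS (S : {set 'I_m}) : (inord #|S| == k :> 'I_m.+1) = (#|S| == k).
    by rewrite -val_eqE /= inordK// ltnS -[X in (_ <= X)%N]card_ord max_card.
  by under eq_bigl => S do rewrite cS; apply: eq_bigr => S /eqP ->.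
(* The sign [a] is its own inverse. The terms [k = 0] and [k = 1] are split off, the latter existing
   by [hm]; multiplied by [a] they give 1 and the sum of the [mComp (g i)] less [m], that is
   [fComp g]. *)
rewrite -[LHS]mul1r -[in LHS]aa -mulrA key big_ltn// big_ltn// expr0 mul1r expr1.
rewrite (big_pred1 finset.set0); last by move=> S; rewrite cards_eq0.
rewrite big_cards1 E0; under eq_bigr => i _ do rewrite E1.
rewrite sumrB -mulr_sumr sumr_const card_ord /fComp.
rewrite [X in _ = _ + X](_ : _ =
    a * \sum_(2 <= k < m.+1) (-1) ^+ k * \sum_(S : {set 'I_m} | #|S| == k) E S); last first.
  by rewrite mulr_sumr; apply: eq_bigr => k _; rewrite exprD -/a mulrA (mulrC a).
have arith (b M B n : int) : b * b = 1 ->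
    b * (b + (-1 * (b * n - b * M) + B)) = M - (n - 1) + b * B.
  move=> bb; transitivity (b * b * (1 - n + M) + b * B); first by ring.
  by rewrite bb; ring.
by rewrite -[a *+ m]mulr_natr natz; exact: arith.
Qed.
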